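(* Let $S=(s_1,\ldots,s_m)$ be a list of distinct positive integers, let $(n_1,\dots,n_m)$ be a list of non-negative integers with $n=n_1+\ldots+n_m \ge 1$, and let $b\ge 1$ be an integer. The number of $S$-omino towers consisting of $n$ blocks, of which exactly $n_i$ have width $s_i$ for each $i$, and having exactly $b$ blocks in the bottom row, equals $$\binom{n}{n_1,\ldots,n_m}\binom{-1+\sum_{i=1}^m s_i n_i }{n-b}.$$ Consequently, the total number of $S$-omino towers consisting of $n$ blocks of which exactly $n_i$ have width $s_i$ for each $i$ (summing over $b\in\{1,\ldots,n\}$) equals $$\binom{n}{n_1,\ldots,n_m} \binom{-1+\sum_{i=1}^m s_i n_i }{n-1} \, {}_2F_1\bigg(1,1-n;1+\sum_{i=1}^m (s_i-1) n_i ;-1\bigg).$$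
   Context: An $S$-omino tower is a finite nonempty set of pairwise non-overlapping blocks in the plane, each block being a rectangle of height $1$ and width $s_i$ for some $i$, placed on the integer lattice: a block occupies the unit columns $a, a+1,\ldots,a+s_i-1$ (for some integer $a$) in some row $r\in\{0,1,2,\ldots\}$. The conditions are: (i) the union of the blocks in the bottom row $r=0$ is convex (a contiguous interval); (ii) every block in a row $r\ge 1$ is supported, i.e. it shares at least one unit column with some block in row $r-1$. Towers are counted up to horizontal translation, and blocks are distinguished only by their width. The Gauss hypergeometric function is ${}_2F_1(a,b;c;z)=\sum_{j=0}^\infty \frac{(a)_j (b)_j}{(c)_j} \frac{z^j}{j!}$, where $(x)_j=x(x+1)\cdots(x+j-1)$ is the rising Pochhammer symbol (here the series terminates since $1-n\le 0$ is an integer). *)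

(* Defs.v *)
From HB Require Import structures.
From mathcomp Require Export all_boot all_order all_algebra finmap.
From mathcomp Require Export all_classical all_reals all_analysis.
Export Order.TTheory GRing.Theory Num.Theory.
Export numFieldNormedType.Exports.

#[export] Set Implicit Arguments.
#[export] Unset Strict Implicit.
#[export] Unset Printing Implicit Defensive.

Local Open Scope fset_scope.
Local Open Scope card_scope.
Local Open Scope classical_set_scope.
Local Open Scope ring_scope.

(* [Block r a w] is the rectangle of height 1 in row [r] occupying the unit
   columns [a, a+1, ..., a+w-1]. *)
Record block := Block { row_of : nat; left_of : int; width_of : nat }.

Definition block_code (B : block) := (row_of B, left_of B, width_of B).
Definition block_decode (c : nat * int * nat) := Block c.1.1 c.1.2 c.2.
Lemma block_codeK : cancel block_code block_decode.
Proof. by case. Qed.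

HB.instance Definition _ := Choice.copy block (can_type block_codeK).

Definition occupies (B : block) (c : int) : bool :=
  (left_of B <= c) && (c < left_of B + (width_of B)%:Z).

Definition share_column (B B' : block) : Prop :=
  exists c : int, occupies B c /\ occupies B' c.

Definition non_overlapping (t : {fset block}) : Prop :=
  forall B B' : block, B \in t -> B' \in t -> B <> B' ->
    row_of B = row_of B' -> ~ share_column B B'.

Definition bottom_columns (t : {fset block}) : set int :=
  [set c | exists B : block, [/\ B \in t, row_of B = 0%N & occupies B c]].

(* The bottom row is a union of unit cells with integer corners, so it is
   convex in the plane iff its set of columns is an interval of integers. *)
Definition convex_bottom (t : {fset block}) : Prop :=
  forall c1 c c2 : int, c1 <= c -> c <= c2 ->
    bottom_columns t c1 -> bottom_columns t c2 -> bottom_columns t c.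

Definition supported (t : {fset block}) : Prop :=
  forall B : block, B \in t -> (0 < row_of B)%N ->
    exists B' : block,
      [/\ B' \in t, (row_of B').+1 = row_of B & share_column B B'].

Definition omino_tower m (s : 'I_m -> nat) (t : {fset block}) : Prop :=
  [/\ t != fset0,
      forall B : block, B \in t -> exists i : 'I_m, width_of B = s i,
      non_overlapping t,
      convex_bottom t
    & supported t].

Definition nb_width (w : nat) (t : {fset block}) : nat :=
  #|` [fset B in t | width_of B == w] |.

Definition nb_bottom (t : {fset block}) : nat :=
  #|` [fset B in t | row_of B == 0%N] |.

Definition translate (k : int) (t : {fset block}) : {fset block} :=
  [fset Block (row_of B) (left_of B + k) (width_of B) | B in t].

Definition translation_class (t : {fset block}) : set {fset block} :=
  [set translate k t | k in [set: int]].

Definition count_up_to_translation (P : set {fset block}) (N : nat) : Prop :=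
  [set translation_class t | t in P] #= `I_N.

Definition towers m (s k : 'I_m -> nat) (n : nat) : set {fset block} :=
  [set t | [/\ omino_tower s t, #|` t| = n & forall i, nb_width (s i) t = k i]].

Definition multinomial m (k : 'I_m -> nat) : nat :=
  ((\sum_(i < m) k i)`! %/ \prod_(i < m) (k i)`!)%N.

(* Binomial coefficient with an integer lower index: it vanishes when the lower
   index is negative, unlike what truncated subtraction would give. *)
Definition binomz (N : nat) (k : int) : nat :=
  if k is Posz j then 'C(N, j) else 0%N.

Definition rising (R : pzRingType) (x : R) (j : nat) : R :=
  \prod_(0 <= i < j) (x + i%:R).

Definition hyp2F1 (R : realType) (a b c z : R) : R :=
  limn (series (fun j : nat =>
    rising a j * rising b j / rising c j * (z ^+ j / j`!%:R))).

(* Main.v *)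
(* Dropping the condition on the bottom row, towers are heaps of pieces: finite
   sets of blocks in which each block rests on another one or on the ground.
   Replacing the row of a block by the length of the longest chain of blocks
   above it turns a heap upside down; this involution exchanges bottom blocks
   and maximal blocks. A tower is thus a heap whose maximal blocks are [b]
   consecutive ones, and, unlike bottom blocks, maximal blocks can be removed
   without disturbing the rest of the heap. Let [Q w b] be the number of heaps
   with block counts [k] and [b] consecutive maximal blocks just after an
   interval of width [w], whose maximal blocks all meet this interval or are
   among these [b] blocks. Then
     [Q w b.+1 = \sum_i Q_i (w + s_i) b]
   where [Q_i] counts heaps with one block of width [s_i] less, and
     [Q w.+1 0 = Q w 0 + Q w 1],   [Q 1 0 = \sum_i s_i * Q_i s_i 0].
   The numbers [multinomial k * 'C(W + w - 1, n - b)], where [W] is the total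
   width, satisfy the same recurrences, and the towers are counted by
   [Q 0 b]. *)
Require Import Defs.
From mathcomp Require Import zify ring.

Local Open Scope classical_set_scope.
Local Open Scope ring_scope.

(** * Cardinality of predicates through duplicate-free lists *)

Definition counted (T : eqType) (P : T -> Prop) (N : nat) : Prop :=
  exists l : seq T, [/\ uniq l, forall x, x \in l <-> P x & size l = N].

Lemma counted_ext (T : eqType) (P Q : T -> Prop) N :
  (forall x, P x <-> Q x) -> counted P N -> counted Q N.
Proof.
move=> PQ [l [ul lP sl]]; exists l; split=> // x.
by rewrite -PQ; apply: lP.
Qed.

Lemma counted0 (T : eqType) (P : T -> Prop) :
  (forall x, ~ P x) -> counted P 0.
Proof. by move=> nP; exists [::]; split=> // x; split=> // /nP. Qed.

Lemma counted1 (T : eqType) (x : T) : counted (fun y => y = x) 1.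
Proof. by exists [:: x]; split=> // y; rewrite inE; split=> /eqP. Qed.

Lemma countedU (T : eqType) (P Q : T -> Prop) M N :
  (forall x, P x -> ~ Q x) -> counted P M -> counted Q N ->
  counted (fun x => P x \/ Q x) (M + N).
Proof.
move=> PQ [l [ul lP <-]] [r [ur rQ <-]].
exists (l ++ r); split; last exact: size_cat.
- rewrite cat_uniq ul ur andbT; apply/hasPn => x /rQ Qx.
  by apply/negP => /lP Px; apply: (PQ x).
- move=> x; rewrite mem_cat; split.
    by case/orP => [/lP|/rQ]; [left|right].
  by case=> [/lP ->|/rQ ->]; rewrite ?orbT.
Qed.

(** The last hypothesis is the pairwise disjointness of the [P i]: a common element forces equal
    indices. *)
Lemma counted_bigU (I T : eqType) (r : seq I) (P : I -> T -> Prop)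
    (N : I -> nat) :
  uniq r -> (forall i, i \in r -> counted (P i) (N i)) ->
  (forall i j x, i \in r -> j \in r -> P i x -> P j x -> i = j) ->
  counted (fun x => exists2 i, i \in r & P i x) (\sum_(i <- r) N i)%N.
Proof.
elim: r => [|i r IH] /= => [_ _ _|/andP[ir ur] cP inj].
  by rewrite big_nil; apply: counted0 => x [].
rewrite big_cons.
apply: (counted_ext (P := fun x => P i x \/ exists2 j, j \in r & P j x)).
  move=> x; split.
    case=> [Pi|[j jr Pj]]; first by exists i; rewrite ?mem_head.
    by exists j; rewrite // inE jr orbT.
  by case=> j; rewrite inE => /orP[/eqP ->|jr] Pj; [left|right; exists j].
apply: countedU.
- move=> x Pi [j jr Pj]; move: ir; rewrite (inj _ _ _ _ _ Pi Pj) ?jr //.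
    exact: mem_head.
  by rewrite inE jr orbT.
- exact/cP/mem_head.
- apply: IH => // [j jr|j j' x jr jr']; first by apply: cP; rewrite inE jr orbT.
  by apply: inj; rewrite inE ?jr ?jr' orbT.
Qed.

Lemma counted_image (T U : eqType) (f : T -> U) (P : T -> Prop) N :
  (forall x y, P x -> P y -> f x = f y -> x = y) ->
  counted P N -> counted (fun y => exists2 x, P x & f x = y) N.
Proof.
move=> f_inj [l [ul lP <-]]; exists (map f l); split; last exact: size_map.
- by rewrite map_inj_in_uniq // => x y /lP Px /lP Py; apply: f_inj.
- move=> y; split=> [/mapP[x /lP Px ->]|[x /lP xl <-]]; first by exists x.
  exact: map_f.
Qed.

(** * Heaps of blocks *)

(** Only columns are compared. Rows are ignored, so the test also applies to a block whose row is
    still to be found, such as [Block 0 l w]. *)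
Definition touch (B C : block) : bool :=
  (left_of B < left_of C + (width_of C)%:Z) &&
  (left_of C < left_of B + (width_of B)%:Z).

Lemma touchC B C : touch B C = touch C B.
Proof. by rewrite /touch andbC. Qed.

Lemma touchxx B : (0 < width_of B)%N -> touch B B.
Proof. by rewrite /touch; lia. Qed.

Lemma share_columnP B C : (0 < width_of B)%N -> (0 < width_of C)%N ->
  share_column B C <-> touch B C.
Proof.
rewrite /share_column /occupies /touch => wB wC; split.
  by case=> c; lia.
move=> h; case: (lerP (left_of B) (left_of C)) => h'.
  by exists (left_of C); lia.
by exists (left_of B); lia.
Qed.

(* The conditions on a tower that do not involve the shape of its bottom row. *)
Definition heap (t : {fset block}) : Prop :=
  [/\ forall B, B \in t -> (0 < width_of B)%N,
      forall B C, B \in t -> C \in t -> touch B C -> row_of B = row_of C ->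
        B = C
    & forall B, B \in t -> (0 < row_of B)%N ->
        exists2 C, C \in t & touch B C /\ (row_of C).+1 = row_of B].

(** These are the maximal elements of the heap order, generated by touching and rising rows; looking
    at touching blocks is enough. *)
Definition maximal (t : {fset block}) (B : block) : Prop :=
  B \in t /\ forall C, C \in t -> touch B C -> (row_of C <= row_of B)%N.

(** The row where a block dropped from above comes to rest; the empty maximum 0 is the ground. *)
Definition height (t : {fset block}) (l : int) (w : nat) : nat :=
  (\max_(C <- t | touch (Block 0 l w) C) (row_of C).+1)%N.

Definition landing t l w : block := Block (height t l w) l w.

Definition place (l : int) (w : nat) (t : {fset block}) : {fset block} :=
  (landing t l w |` t)%fset.

Lemma height_gt t l w C : C \in t -> touch (Block 0 l w) C ->
  (row_of C < height t l w)%N.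
Proof.
move=> Ct tC; rewrite /height.
exact: (@leq_bigmax_seq _ _ _ (fun C => (row_of C).+1)).
Qed.

Lemma height_attained t l w : (0 < height t l w)%N ->
  exists2 C, C \in t & touch (Block 0 l w) C /\ (row_of C).+1 = height t l w.
Proof.
rewrite /height big_seq_cond.
apply: (big_ind (fun n => (0 < n)%N -> exists2 C, C \in t &
   touch (Block 0 l w) C /\ (row_of C).+1 = n)) => //.
- by move=> x y hx hy; rewrite /maxn; case: ifP.
- by move=> C /andP[Ct tC] _; exists C.
Qed.

Lemma landing_notin t l w : (0 < w)%N -> landing t l w \notin t.
Proof.
move=> w0; apply/negP => pt; have := @height_gt t l w _ pt.
by rewrite ltnn => /(_ (touchxx _))/=; rewrite w0 => /(_ isT).
Qed.

Lemma heap0 : heap fset0. Proof. by split. Qed.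

Lemma heap_place t l w : (0 < w)%N -> heap t -> heap (place l w t).
Proof.
move=> w0 [wt ot st]; rewrite /place; split.
- by move=> B /fset1UP[->|/wt].
- move=> B C /fset1UP[->|Bt] /fset1UP[->|Ct] // tBC rBC.
  + by have := height_gt Ct tBC; move: rBC => /= ->; rewrite ltnn.
  + by rewrite touchC in tBC; have := height_gt Bt tBC; move: rBC => /= <-;
      rewrite ltnn.
  + exact: ot.
- move=> B /fset1UP[-> /= h0|Bt /(st _ Bt)[C Ct tC]]; last first.
    by exists C => //; apply/fset1UP; right.
  have [C Ct tC] := height_attained h0; exists C => //.
  by apply/fset1UP; right.
Qed.

Lemma maximal_landing t l w : maximal (place l w t) (landing t l w).
Proof.
split=> [|C]; first exact: fset1U1.
by move=> /fset1UP[->//|Ct tC]; apply/ltnW/(height_gt Ct tC).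
Qed.

(** Each of the two blocks is at most as high as the other, so they share a row, where touching
    blocks coincide. *)
Lemma maximal_touch_eq t B C : heap t -> maximal t B -> maximal t C ->
  touch B C -> B = C.
Proof.
move=> [_ ot _] [Bt mB] [Ct mC] tBC; apply: ot => //.
by apply/eqP; rewrite eqn_leq mC ?mB // touchC.
Qed.

Lemma maximal_left_eq t B C : heap t -> maximal t B -> maximal t C ->
  left_of B = left_of C -> B = C.
Proof.
move=> ht mB mC lBC; apply: (maximal_touch_eq ht mB mC).
case: ht => wt _ _; have := wt _ mB.1; have := wt _ mC.1.
by rewrite /touch lBC; lia.
Qed.

Lemma placeK t l w : (0 < w)%N -> (place l w t `\ landing t l w)%fset = t.
Proof. by move=> w0; rewrite /place fsetU1K // landing_notin. Qed.

(** The two landing blocks are maximal in the same heap and have the same left end, so they are one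
    block; deleting it gives back both [t] and [u]. *)
Lemma place_inj l w t u : (0 < w)%N -> heap t ->
  place l w t = place l w u -> t = u.
Proof.
move=> w0 ht e.
have m1 := maximal_landing t l w; have m2 := maximal_landing u l w.
rewrite -e in m2.
have eB := maximal_left_eq (heap_place l w0 ht) m1 m2 erefl.
by rewrite -(placeK t l w0) -(placeK u l w0) e eB.
Qed.

Lemma heap_remove t B : heap t -> maximal t B -> heap (t `\ B)%fset.
Proof.
move=> [wt ot st] [Bt mB]; split.
- by move=> C /fsetD1P[_ /wt].
- by move=> C D /fsetD1P[_ Ct] /fsetD1P[_ Dt]; apply: ot.
- move=> C /fsetD1P[_ Ct] /(st _ Ct)[D Dt [tD rD]]; exists D => //.
  (* A block resting on [B] would touch it from above, against maximality. *)
  apply/fsetD1P; split=> //; apply/eqP => DB; move: tD rD.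
  by rewrite DB touchC => /(mB _ Ct); lia.
Qed.

(** A maximal block already lies where it would land: it is above all other blocks that touch it,
    and its support remains after the removal. *)
Lemma remove_place t B : heap t -> maximal t B ->
  place (left_of B) (width_of B) (t `\ B)%fset = t.
Proof.
move=> ht mB; have [wt ot st] := ht; have [Bt hB] := mB.
rewrite /place; have -> : landing (t `\ B)%fset (left_of B) (width_of B) = B.
  suff hr : height (t `\ B)%fset (left_of B) (width_of B) = row_of B.
    by rewrite /landing hr; case: (B).
  apply/eqP; rewrite eqn_leq; apply/andP; split.
    case: (posnP (height (t `\ B)%fset (left_of B) (width_of B))) => [->//|].
    move=> /height_attained[C /fsetD1P[CB Ct] [tC <-]].
    rewrite ltn_neqAle hB // andbT; apply: contraNneq CB => rC.
    by rewrite eq_sym; apply/eqP/ot.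
  case: (posnP (row_of B)) => [->//|/(st _ Bt)[C Ct [tC rC]]].
  rewrite -rC; apply: height_gt => //; apply/fsetD1P; split=> //.
  by apply/eqP => CB; move: rC; rewrite CB; lia.
by rewrite fsetD1K.
Qed.

(** From a block that is not maximal one climbs to a strictly higher one, and rows are bounded by
    [M]. *)
Lemma maximal_exists t : heap t -> t != fset0 -> exists B, maximal t B.
Proof.
move=> ht /fset0Pn[B0 B0t].
pose M := (\max_(C <- t) row_of C)%N.
have Mle C : C \in t -> (row_of C <= M)%N.
  by move=> Ct; apply: (@leq_bigmax_seq _ _ _ row_of).
have [n le_n] : exists n, (M - row_of B0 <= n)%N by exists (M - row_of B0)%N.
elim: n => [|n IH] in B0 B0t le_n *.
  exists B0; split=> // C Ct _; have := Mle _ Ct; have := Mle _ B0t; lia.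
case: (pselect (maximal t B0)) => [|nm]; first by exists B0.
have [C [Ct lt]] : exists C, C \in t /\ (row_of B0 < row_of C)%N.
  apply: contrapT => nC; apply: nm; split=> // C Ct _.
  by rewrite leqNgt; apply/negP => lt; apply: nC; exists C.
by apply: (IH C) => //; have := Mle _ Ct; lia.
Qed.

(** * Multinomial coefficients *)

Definition decr (m : nat) (k : 'I_m -> nat) (i : 'I_m) : 'I_m -> nat :=
  fun j => (k j - (j == i))%N.

Lemma sum_decr m (f k : 'I_m -> nat) i : (0 < k i)%N ->
  (\sum_j f j * k j = \sum_j f j * decr k i j + f i)%N.
Proof.
move=> ki; rewrite (bigD1 i) //= [in RHS](bigD1 i) //= /decr eqxx.
rewrite [in RHS](eq_bigr (fun j => f j * k j)%N); last first.
  by move=> j /negPf ->; rewrite subn0.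
have -> : (f i * k i = f i * (k i - 1) + f i)%N.
  by rewrite -mulnSr subn1 prednK.
by rewrite addnAC.
Qed.

Lemma sum_decr1 m (k : 'I_m -> nat) i : (0 < k i)%N ->
  (\sum_j k j = (\sum_j decr k i j).+1)%N.
Proof.
move=> ki; rewrite -addn1 -[LHS]mul1n -[X in (X + 1)%N]mul1n !big_distrr /=.
exact: (sum_decr (fun=> 1%N)).
Qed.

Lemma prod_fact_dvdn (I : Type) (r : seq I) (k : I -> nat) :
  (\prod_(i <- r) (k i)`! %| (\sum_(i <- r) k i)`!)%N.
Proof.
elim: r => [|i r IH]; first by rewrite !big_nil.
rewrite !big_cons; set S := (\sum_(j <- r) k j)%N.
have /= <- := bin_fact (leq_addr S (k i)).
by rewrite addKn dvdn_mull // dvdn_mul.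
Qed.

Lemma multinomial_fact m (k : 'I_m -> nat) :
  (multinomial k * \prod_i (k i)`! = (\sum_i k i)`!)%N.
Proof. exact/divnK/prod_fact_dvdn. Qed.

Lemma multinomial_decr m (k : 'I_m -> nat) i : (0 < k i)%N ->
  ((\sum_j k j) * multinomial (decr k i) = k i * multinomial k)%N.
Proof.
move=> ki; have P0 : (0 < \prod_j (decr k i j)`!)%N.
  by rewrite prodn_gt0 // => j; apply: fact_gt0.
apply/eqP; rewrite -(eqn_pmul2r P0) -mulnA multinomial_fact.
rewrite {1}(sum_decr1 ki) -factS -(sum_decr1 ki) -multinomial_fact.
apply/eqP; rewrite (bigD1 i) //= [in RHS](bigD1 i) //= /decr eqxx.
rewrite [in RHS](eq_bigr (fun j => (k j)`!)); last first.
  by move=> j /negPf ->; rewrite subn0.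
by rewrite -{1}(prednK ki) factS prednK // subn1; lia.
Qed.

(** After multiplication by the total [n], the term of index [i] becomes [k i * multinomial k], and
    the [k i] add up to [n]. *)
Lemma multinomial_rec m (k : 'I_m -> nat) : (0 < \sum_i k i)%N ->
  (\sum_(i | (0 < k i)%N) multinomial (decr k i) = multinomial k)%N.
Proof.
move=> n0; apply/eqP; rewrite -(eqn_pmul2l n0) big_distrr /=; apply/eqP.
under eq_bigr => i ki do rewrite multinomial_decr //.
rewrite big_distrl /= [RHS](bigID (fun i => (0 < k i)%N)) /=.
by rewrite [X in (_ + X)%N]big1 ?addn0 // => i; rewrite -eqn0Ngt => /eqP ->.
Qed.

(** The numerical side of the recurrence for a single column. With [W] the total width, it follows
    from [n * 'C(W, n) = W * 'C(W - 1, n - 1)] and the expansion of [W] as a sum of [s i * k i]. *)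
Lemma multinomial_rec_weighted m (s k : 'I_m -> nat) : (0 < \sum_i k i)%N ->
  (\sum_(i | (0 < k i)%N) s i * multinomial (decr k i) *
     'C((\sum_i s i * k i).-1, (\sum_i k i).-1) =
   multinomial k * 'C(\sum_i s i * k i, \sum_i k i))%N.
Proof.
move=> n0; apply/eqP; rewrite -(eqn_pmul2l n0) big_distrr /=; apply/eqP.
have ->: ((\sum_i k i) * (multinomial k * 'C(\sum_i s i * k i, \sum_i k i)) =
  multinomial k * ((\sum_i s i * k i) *
     'C((\sum_i s i * k i).-1, (\sum_i k i).-1)))%N.
  by rewrite mulnCA mul_bin_diag prednK.
rewrite [in RHS]big_distrl big_distrr /=.
rewrite [RHS](bigID (fun i => (0 < k i)%N)) /=.
rewrite [X in (_ + X)%N]big1 ?addn0; last first.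
  by move=> i; rewrite -eqn0Ngt => /eqP ->; rewrite muln0 mul0n muln0.
apply: eq_bigr => i /multinomial_decr e; set c := 'C(_, _).
by have := congr1 (fun x => s i * x * c)%N e; rewrite /=; lia.
Qed.

(** * Cardinalities of filtered and extended finite sets *)

Lemma card_fset_filter (T : choiceType) (t : {fset T}) (p : pred T) :
  #|` [fset x in t | p x]%fset| = count p t.
Proof.
rewrite -size_filter; apply/perm_size/uniq_perm => [||x].
- exact: fset_uniq.
- exact/filter_uniq/fset_uniq.
- by rewrite mem_filter !inE /= andbC.
Qed.

Lemma perm_fset1U (T : choiceType) (t : {fset T}) x : x \notin t ->
  perm_eq (x |` t)%fset (x :: t).
Proof.
move=> xt; apply: uniq_perm; rewrite ?fset_uniq //= ?xt ?fset_uniq //.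
by move=> y; rewrite !inE.
Qed.

(** * Counting heaps by removing maximal blocks *)

Definition typed m (s k : 'I_m -> nat) (t : {fset block}) : Prop :=
  (forall B, B \in t -> exists i, width_of B = s i) /\
  forall i, nb_width (s i) t = k i.

Lemma typed1U m (s k : 'I_m -> nat) i t B : injective s -> B \notin t ->
  width_of B = s i ->
  typed s k (B |` t)%fset <-> (0 < k i)%N /\ typed s (decr k i) t.
Proof.
move=> s_inj Bt wB; rewrite /typed /nb_width.
have cnt j : #|` [fset C in (B |` t) | width_of C == s j]%fset| =
    ((j == i) + #|` [fset C in t | width_of C == s j]%fset|)%N.
  rewrite !card_fset_filter (permP (perm_fset1U Bt)) /= wB (inj_eq s_inj).
  by rewrite eq_sym.
split.
  case=> ws kT; split; first by rewrite -kT cnt eqxx.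
  split=> [C Ct|j]; first by apply: ws; apply/fset1UP; right.
  by rewrite /decr -kT cnt addKn.
case=> ki [ws kt]; split=> [C /fset1UP[->|/ws//]|j]; first by exists i.
rewrite cnt kt /decr; case: eqP => [->|_]; last by rewrite subn0.
by rewrite add1n subn1 prednK.
Qed.

(** Each block begins at the column where the previous one ends; the rows may differ, as they do for
    maximal blocks. *)
Fixpoint chain (P : block -> Prop) (e : int) (b : nat) (e' : int) : Prop :=
  if b is b'.+1 then
    exists B, [/\ P B, left_of B = e & chain P (e + (width_of B)%:Z) b' e']
  else e' = e.

Definition meets (e e' : int) (B : block) : bool :=
  (left_of B < e') && (e < left_of B + (width_of B)%:Z).

Lemma chain_le P e b e' : chain P e b e' -> e <= e'.
Proof.
elim: b e => [|b IH] e /= => [->//|[B [_ _ /IH]]]; lia.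
Qed.

(** All blocks of a chain start at or to the right of its origin, so the implication is needed only
    there. *)
Lemma chain_mono (P Q : block -> Prop) e0 e b e' :
  (forall B, P B -> e0 <= left_of B -> Q B) -> e0 <= e ->
  chain P e b e' -> chain Q e b e'.
Proof.
move=> PQ; elim: b e => [//|b IH] e e0e /= [B [PB lB c]].
exists B; split=> //; first by apply: PQ => //; rewrite lB.
by apply: IH c; lia.
Qed.

(* Heaps with block counts [k] having [b] consecutive maximal blocks that start
   at column [a + w], all maximal blocks meeting the interval which begins at
   [a] and ends where these [b] blocks end. *)
Definition capped m (s k : 'I_m -> nat) (a : int) (w b : nat)
    (t : {fset block}) : Prop :=
  [/\ heap t, typed s k t
    & exists2 e', chain (maximal t) (a + w%:Z) b e'
                & forall B, maximal t B -> meets a e' B].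

Lemma maximal_place t l w B : maximal (place l w t) B ->
  B = landing t l w \/ maximal t B.
Proof.
move=> [/fset1UP[->|Bt] mB]; first by left.
right; split=> // C Ct; apply: mB; apply/fset1UP; by right.
Qed.

Lemma maximal_placeE t l w B : (0 < w)%N -> maximal t B ->
  ~~ touch (Block 0 l w) B -> maximal (place l w t) B.
Proof.
move=> w0 [Bt mB] nt; split; first by apply/fset1UP; right.
by move=> C /fset1UP[->|/mB//]; rewrite touchC => tB; case/negP: nt.
Qed.

Lemma maximal_remove t B C : maximal t C -> C <> B -> maximal (t `\ B)%fset C.
Proof.
move=> [Ct mC] CB; split; first by apply/fsetD1P; split=> //; apply/eqP.
by move=> D /fsetD1P[_ /mC].
Qed.

(** Removing a maximal block can only uncover blocks that touch it. *)
Lemma maximal_remove_inv t B C : maximal t B -> maximal (t `\ B)%fset C ->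
  maximal t C \/ touch B C.
Proof.
move=> mB [/fsetD1P[CB Ct] mC].
case: (boolP (touch B C)) => tBC; first by right.
left; split=> // D Dt; case: (eqVneq D B) => [->|DB].
  by rewrite touchC (negPf tBC).
by apply: mC; apply/fsetD1P.
Qed.

Lemma typed_place m (s k : 'I_m -> nat) i t l : injective s -> (0 < s i)%N ->
  typed s k (place l (s i) t) <-> (0 < k i)%N /\ typed s (decr k i) t.
Proof. by move=> s_inj si; apply: typed1U; rewrite ?landing_notin. Qed.

Lemma typed_remove m (s k : 'I_m -> nat) i t B : injective s -> B \in t ->
  width_of B = s i ->
  typed s k t -> (0 < k i)%N /\ typed s (decr k i) (t `\ B)%fset.
Proof.
move=> s_inj Bt wB tt; apply/(typed1U _ s_inj _ wB); last by rewrite fsetD1K.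
by rewrite !inE eqxx.
Qed.

(** The first of the [b.+1] consecutive blocks is removed. What it uncovers touches it, hence meets
    the interval once this is extended by [s i]. Conversely, the later blocks of the chain do not
    touch the block put back, so they stay maximal. *)
Lemma capped_step m (s k : 'I_m -> nat) a w b T :
  injective s -> (forall i, (0 < s i)%N) ->
  (exists2 i, i \in [seq i <- enum 'I_m | (0 < k i)%N] &
   exists2 t, capped s (decr k i) a (w + s i) b t &
              place (a + w%:Z) (s i) t = T) <->
  capped s k a w b.+1 T.
Proof.
move=> s_inj s0; split.
  case=> i; rewrite mem_filter => /andP[ki _] [t [ht tt [e' ce' mt]] <-].
  split; [exact: heap_place|by rewrite typed_place|exists e'].
    exists (landing t (a + w%:Z) (s i)); split=> //.
      exact: maximal_landing.
    rewrite /=; apply: (@chain_mono (maximal t) _ _ _ _ _ _ (lexx _)).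
      move=> B mB lB; apply: (maximal_placeE (s0 i) mB).
      by rewrite /touch /=; move: lB; lia.
    by move: ce'; rewrite PoszD addrA.
  move=> B /maximal_place[->|/mt//].
  rewrite /meets /=; have := chain_le ce'; have := s0 i; lia.
case=> ht tt [e' [B [mB lB ce']] mt].
have [Bt hB] := mB; have [i wB] := tt.1 _ Bt.
have [ki tt'] := typed_remove s_inj Bt wB tt.
exists i; first by rewrite mem_filter ki mem_enum.
exists (T `\ B)%fset; last by rewrite -lB -wB remove_place.
have wB0 : (0 < width_of B)%N by rewrite wB.
split; [exact: heap_remove|exact: tt'|exists e'].
  rewrite PoszD addrA -wB; apply: (@chain_mono (maximal T) _ _ _ _ _ _ (lexx _)) ce'.
  move=> C mC lC; apply: maximal_remove => // CB.
  by move: lC; rewrite CB lB; lia.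
move=> C mC; have [/mt//|] := maximal_remove_inv mB mC.
by have := chain_le ce'; rewrite /touch /meets lB; lia.
Qed.

(** Either all maximal blocks already meet the shorter interval, or one of them meets only the added
    column [a + w]. The latter then starts exactly there and is a chain of length one; the other
    maximal blocks do not touch it, so they meet the shorter interval. *)
Lemma capped_widen m (s k : 'I_m -> nat) a w T :
  (forall i, (0 < s i)%N) -> (0 < w)%N ->
  (capped s k a w 0 T \/ capped s k a w 1 T) <-> capped s k a w.+1 0 T.
Proof.
move=> s0 w0; split.
  case=> [[ht tt [e' /= -> mt]]|[ht tt [e' [B [mB lB /= ->]] mt]]].
    split=> //; exists (a + w.+1%:Z) => // B /mt; rewrite /meets; lia.
  split=> //; exists (a + w.+1%:Z) => // C mC.
  case: (boolP (touch B C)) => [tBC|].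
    rewrite -(maximal_touch_eq ht mB mC tBC) /meets lB.
    case: ht => wt _ _; have := wt _ mB.1; lia.
  have := mt _ mC; rewrite /meets /touch lB; lia.
case=> ht tt [e' /= -> mt].
case: (pselect (forall B, maximal T B -> meets a (a + w%:Z) B)) => [h|nh].
  by left; split=> //; exists (a + w%:Z).
right; have [B [mB nB]] : exists B, maximal T B /\ ~~ meets a (a + w%:Z) B.
  apply: contrapT => h; apply: nh => B mB; apply: contrapT => /negP nB.
  by apply: h; exists B.
have lB : left_of B = a + w%:Z.
  by have := mt _ mB; move: nB; rewrite /meets; lia.
have wB : (0 < width_of B)%N by case: ht => wt _ _; apply: wt mB.1.
split=> //; exists (a + w%:Z + (width_of B)%:Z); first by exists B.
move=> C /mt; rewrite /meets; lia.
Qed.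

Lemma capped_widen_disjoint m (s k : 'I_m -> nat) a w T :
  capped s k a w 0 T -> ~ capped s k a w 1 T.
Proof.
move=> [ht _ [e' /= -> mt]] [_ _ [e'' [B [mB lB _]] _]].
by have := mt _ mB; rewrite /meets lB; lia.
Qed.

(** Maximal blocks through one column touch each other, so a nonempty heap has exactly one. Here [j]
    is the offset of column [a] inside it. Once it is removed, every maximal block touches it, that
    is, meets the interval it occupied. *)
Lemma capped_cell m (s k : 'I_m -> nat) a T :
  injective s -> (forall i, (0 < s i)%N) ->
  ((typed s k fset0 /\ T = fset0) \/
   exists2 i, i \in [seq i <- enum 'I_m | (0 < k i)%N] &
   exists2 j, j \in iota 0 (s i) &
   exists2 t, capped s (decr k i) (a - j%:Z) (s i) 0 t &
              place (a - j%:Z) (s i) t = T) <->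
  capped s k a 1 0 T.
Proof.
move=> s_inj s0; split.
  case=> [[tt ->]|[i]].
    by split; [exact: heap0|exact: tt|exists (a + 1) => // B []].
  rewrite mem_filter => /andP[ki _] [j]; rewrite mem_iota => js.
  case=> t [ht tt [e' /= -> mt]] <-.
  have hT := heap_place (a - j%:Z) (s0 i) ht.
  have mp := maximal_landing t (a - j%:Z) (s i).
  split=> //; first by rewrite typed_place.
  exists (a + 1) => // B mB.
  suff -> : B = landing t (a - j%:Z) (s i) by rewrite /meets /=; lia.
  case: (maximal_place mB) => // /mt hB.
  apply/esym/(maximal_touch_eq hT mp mB).
  by move: hB; rewrite /meets /touch /=; lia.
case=> ht tt [e' /= -> mt].
case: (eqVneq T fset0) => [T0|T0].
  by left; split=> //; rewrite -T0.
right; have [B mB] := maximal_exists ht T0.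
have mtB := mt _ mB; have [i wB] := tt.1 _ mB.1.
have [ki tt'] := typed_remove s_inj mB.1 wB tt.
exists i; first by rewrite mem_filter ki mem_enum.
have [j ja] : exists j : nat, left_of B = a - j%:Z.
  by exists `|a - left_of B|%N; move: mtB; rewrite /meets; lia.
exists j; first by rewrite mem_iota; move: mtB; rewrite /meets ja wB; lia.
exists (T `\ B)%fset; last by rewrite -ja -wB remove_place.
split; [exact: heap_remove|exact: tt'|exists (a - j%:Z + (s i)%:Z) => //].
move=> C mC; have [mC'|] := maximal_remove_inv mB mC.
  have tBC : touch B C.
    by have := mt _ mC'; move: mtB; rewrite /meets /touch; lia.
  have := maximal_touch_eq ht mB mC' tBC.
  by move=> BC; case: mC; rewrite BC !inE eqxx.
by rewrite /touch /meets -ja -wB; lia.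
Qed.

Lemma place_sep t u l l' w w' : heap t -> (0 < w)%N ->
  touch (Block 0 l w) (Block 0 l' w') ->
  place l w t = place l' w' u -> l = l' /\ w = w'.
Proof.
move=> ht w0 tB e; have m1 := maximal_landing t l w.
have m2 := maximal_landing u l' w'; rewrite -e in m2.
by case: (maximal_touch_eq (heap_place l w0 ht) m1 m2 tB).
Qed.

Lemma typed0 m (s k : 'I_m -> nat) :
  typed s k fset0 <-> (\sum_i k i = 0)%N.
Proof.
have nb0 i : nb_width (s i) fset0 = 0%N.
  by rewrite /nb_width card_fset_filter.
split=> [[_ k0]|].
  by apply: big1 => i _; rewrite -k0 nb0.
move/eqP; rewrite sum_nat_eq0 => /forallP k0; split=> // i.
by rewrite nb0; apply/esym/eqP/k0.
Qed.

Lemma big_filter_enum (I : finType) (P : pred I) (F : I -> nat) :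
  (\sum_(i <- [seq i <- enum I | P i]) F i = \sum_(i | P i) F i)%N.
Proof. by rewrite big_filter big_enum_cond. Qed.

(** Strong induction on the number of blocks. The case [b > 0] removes one block; the case [b = 0]
    is an inner induction on [w] down to a single column. The subtraction of 1 truncates only if
    there is no block and [w = 0]; then [b > 0] and the lower index is negative. *)
Lemma counted_capped m (s k : 'I_m -> nat) (n : nat) a w b :
  injective s -> (forall i, (0 < s i)%N) ->
  n = (\sum_i k i)%N -> (0 < w + b)%N ->
  counted (capped s k a w b)
    (multinomial k * binomz (\sum_i s i * k i + w - 1) (n%:Z - b%:Z)).
Proof.
move=> s_inj s0; elim/ltn_ind: n => n IHn in k a w b *.
move=> nk wb.
have sub i a' w' b' : (0 < k i)%N -> (0 < w' + b')%N ->
    counted (capped s (decr k i) a' w' b')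
      (multinomial (decr k i) *
       binomz (\sum_j s j * decr k i j + w' - 1) (n.-1%:Z - b'%:Z)).
  move=> ki wb'; apply: IHn => //; rewrite nk (sum_decr1 ki) //=.
have step a' w' b' :
    counted (capped s k a' w' b'.+1)
      (multinomial k * binomz (\sum_i s i * k i + w' - 1) (n%:Z - b'.+1%:Z)).
  apply: counted_ext (fun T => capped_step k a' w' b' T s_inj s0) _.
  have -> : (multinomial k *
       binomz (\sum_i s i * k i + w' - 1) (n%:Z - b'.+1%:Z) =
     \sum_(i <- [seq i <- enum 'I_m | (0 < k i)%N]) multinomial (decr k i) *
       binomz (\sum_j s j * decr k i j + (w' + s i) - 1) (n.-1%:Z - b'%:Z))%N.
    rewrite big_filter_enum.
    (* Without blocks the lower index is negative on the left and the sum on the right is empty. *)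
    case: (posnP n) => [n0|n0].
      rewrite n0 sub0r /= muln0 big1 // => i ki.
      by move: nk; rewrite (sum_decr1 ki) n0.
    rewrite -multinomial_rec -?nk // big_distrl /=; apply: eq_bigr => i ki.
    rewrite (sum_decr s ki); congr (_ * binomz _ _)%N; last by lia.
    by rewrite addnA addnAC.
  apply: counted_bigU.
  - by rewrite filter_uniq // enum_uniq.
  - move=> i; rewrite mem_filter => /andP[ki _]; apply: counted_image.
      by move=> t u [ht _ _] _; apply: place_inj.
    by apply: sub => //; have := s0 i; lia.
  - move=> i j T _ _ [t [ht _ _] <-] [u _ /esym e]; apply: s_inj.
    apply: (place_sep ht (s0 i) _ e).2.
    by rewrite /touch /=; have := s0 i; have := s0 j; lia.
case: b wb => [|b] wb; last exact: step.
rewrite addn0 in wb; rewrite subr0 /=.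
elim: w wb => [//|[_ _|w IHw _]]; last first.
  apply: counted_ext (fun T => @capped_widen _ s k a w.+1 T s0 isT) _.
  (* For [n = 0] the term with one maximal block vanishes, its lower index being -1; otherwise this
     is Pascal's rule. *)
  case: (posnP n) => [n0|n0].
    have -> : (multinomial k * 'C(\sum_i s i * k i + w.+2 - 1, n) =
      multinomial k * 'C(\sum_i s i * k i + w.+1 - 1, n) +
      multinomial k * binomz (\sum_i s i * k i + w.+1 - 1) (n%:Z - 1%:Z))%N.
      by rewrite n0 /= !bin0; lia.
    by apply: countedU; [exact: capped_widen_disjoint|exact: IHw|exact: step].
  have -> : (multinomial k * 'C(\sum_i s i * k i + w.+2 - 1, n) =
      multinomial k * 'C(\sum_i s i * k i + w.+1 - 1, n) +
      multinomial k * binomz (\sum_i s i * k i + w.+1 - 1) (n%:Z - 1%:Z))%N.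
    have -> : n%:Z - 1%:Z = n.-1 by lia.
    by rewrite /= -{1 2}(prednK n0) !addnS !subn1 /= binS mulnDr.
  by apply: countedU; [exact: capped_widen_disjoint|exact: IHw|exact: step].
apply: counted_ext (fun T => capped_cell k a T s_inj s0) _.
rewrite addnK; case: (posnP n) => [n0|n0].
  rewrite n0 bin0 muln1; have k0 : (\sum_i k i = 0)%N by rewrite -nk.
  have ki i : k i = 0%N.
    by move/eqP: k0; rewrite sum_nat_eq0 => /forallP/(_ i)/eqP.
  have -> : multinomial k = 1%N.
    by rewrite /multinomial k0 big1 // => i _; rewrite ki.
  apply: counted_ext (counted1 fset0) => T; split=> [->|].
    by left; split=> //; apply/typed0.
  by case=> [[]//|[i]]; rewrite mem_filter ki.
apply: (counted_ext (P := fun T =>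
   exists2 i, i \in [seq i <- enum 'I_m | (0 < k i)%N] &
   exists2 j, j \in iota 0 (s i) &
   exists2 t, capped s (decr k i) (a - j%:Z) (s i) 0 t &
              place (a - j%:Z) (s i) t = T)).
  by move=> T; split; [right|case=> // -[/typed0]; rewrite -nk => n0'; lia].
rewrite nk -multinomial_rec_weighted -?nk //.
rewrite -big_filter_enum.
(* Both placed blocks cover column [a], so they touch and must coincide: width and offset can be
   read off the resulting heap. *)
have sep i j i' j' t u : heap t -> j \in iota 0 (s i) ->
    j' \in iota 0 (s i') ->
    place (a - j%:Z) (s i) t = place (a - j'%:Z) (s i') u -> i = i' /\ j = j'.
  rewrite !mem_iota => ht ji ji' /(place_sep ht (s0 i)) [].
    by rewrite /touch /=; lia.
  by move=> ? /s_inj ->; split=> //; lia.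
apply: counted_bigU.
- by rewrite filter_uniq // enum_uniq.
- move=> i; rewrite mem_filter => /andP[ki _].
  (* The count does not depend on the offset, so the [s i] offsets contribute the factor [s i]. *)
  rewrite [X in counted _ X](_ : _ =
    \sum_(j <- iota 0 (s i)) multinomial (decr k i) *
       binomz (\sum_j s j * decr k i j + s i - 1) (n.-1%:Z - 0%:Z))%N; last first.
    rewrite big_const_seq count_predT size_iota iter_addn_0.
    by rewrite subr0 /= -(sum_decr s ki) subn1 [RHS]mulnC mulnA nk.
  apply: counted_bigU; first exact: iota_uniq.
  + move=> j _; apply: counted_image.
      by move=> t u [ht _ _] _; apply: place_inj.
    by apply: sub => //; have := s0 i; lia.
  + move=> j j' T ji ji' [t [ht _ _] <-] [u _ /esym e].
    by have [] := sep _ _ _ _ _ _ ht ji ji' e.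
- move=> i i' T _ _ [j ji [t [ht _ _] <-]] [j' ji' [u _ /esym e]].
  by have [] := sep _ _ _ _ _ _ ht ji ji' e.
Qed.

(** * Turning heaps upside down *)

Fixpoint depth_rec (n : nat) (t : {fset block}) (B : block) : nat :=
  if n is n'.+1 then
    \max_(C <- t | touch B C && (row_of B < row_of C)%N) (depth_rec n' t C).+1
  else 0.

(* The fuel suffices because rows increase along the chains counted here. *)
Definition depth (t : {fset block}) : block -> nat :=
  depth_rec (\max_(C <- t) row_of C) t.

(** Once the fuel is at least [M - row_of C], one more unit changes nothing, so the fixpoint can be
    unfolded with its fuel restored. *)
Lemma depthE t B :
  depth t B = \max_(C <- t | touch B C && (row_of B < row_of C)%N) (depth t C).+1.
Proof.
set M := \max_(C <- t) row_of C.
have Mle C : C \in t -> (row_of C <= M)%N.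
  by move=> Ct; apply: (@leq_bigmax_seq _ _ _ row_of).
suff fuel n : forall C, (M - row_of C <= n)%N ->
    depth_rec n.+1 t C = depth_rec n t C.
  by rewrite [LHS]/depth -/M -fuel ?leq_subr.
elim: n => [|n IH] C hC.
  rewrite /= big_seq_cond big1 // => D /and3P[Dt _ CD].
  by have := Mle _ Dt; lia.
rewrite [LHS]/= [RHS]/= big_seq_cond [RHS]big_seq_cond.
apply: eq_bigr => D /and3P[Dt _ CD]; congr S; apply: IH; lia.
Qed.

Lemma depth_lt t B C : C \in t -> touch B C -> (row_of B < row_of C)%N ->
  (depth t C < depth t B)%N.
Proof.
move=> Ct tBC rBC; rewrite [depth t B]depthE.
by apply: (@leq_bigmax_seq _ _ _ (fun C => (depth t C).+1)); rewrite // tBC.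
Qed.

Lemma depth_attained t B : (0 < depth t B)%N -> exists2 C, C \in t &
  [/\ touch B C, (row_of B < row_of C)%N & (depth t C).+1 = depth t B].
Proof.
rewrite depthE big_seq_cond.
apply: (big_ind (fun n => (0 < n)%N -> exists2 C, C \in t &
   [/\ touch B C, (row_of B < row_of C)%N & (depth t C).+1 = n])) => //.
- by move=> x y hx hy; rewrite /maxn; case: ifP.
- by move=> C /and3P[Ct tC rC] _; exists C.
Qed.

Definition flipb (t : {fset block}) (B : block) : block :=
  Block (depth t B) (left_of B) (width_of B).

Definition flip (t : {fset block}) : {fset block} := [fset flipb t B | B in t]%fset.

Lemma flipP t B : reflect (exists2 C, C \in t & B = flipb t C) (B \in flip t).
Proof. exact: imfsetP. Qed.

Lemma depth_neq t B C : heap t -> B \in t -> C \in t -> touch B C ->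
  depth t B = depth t C -> B = C.
Proof.
move=> [_ ot _] Bt Ct tBC dBC; apply: ot => //.
case: (ltngtP (row_of B) (row_of C)) => // r.
- by have := depth_lt Ct tBC r; rewrite dBC ltnn.
- by rewrite touchC in tBC; have := depth_lt Bt tBC r; rewrite dBC ltnn.
Qed.

(** The new support of a block is the next block on a longest chain above it. *)
Lemma heap_flip t : heap t -> heap (flip t).
Proof.
move=> ht; have [wt ot st] := ht; split.
- by move=> _ /flipP[B /wt wB ->].
- move=> _ _ /flipP[B Bt ->] /flipP[C Ct ->] tBC dBC.
  by rewrite (depth_neq ht Bt Ct tBC dBC).
- move=> _ /flipP[B Bt ->] /depth_attained[C Ct [tBC _ dC]].
  by exists (flipb t C); first by apply/flipP; exists C.
Qed.

(** Chains above the flipped block are chains going down from [B] in [t]. Rows drop strictly along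
    them, which bounds their length by [row_of B]; following supports down to the ground attains
    this bound. *)
Lemma flipbK t B : heap t -> B \in t -> flipb (flip t) (flipb t B) = B.
Proof.
move=> ht Bt; have [wt ot st] := ht.
have mem C : C \in t -> flipb t C \in flip t by move=> Ct; apply/flipP; exists C.
suff dB : depth (flip t) (flipb t B) = row_of B.
  by rewrite {1}/flipb dB; case: (B).
apply/eqP; rewrite eqn_leq; apply/andP; split.
  have [n] := ubnP (depth (flip t) (flipb t B)).
  elim: n => // n IH in B Bt *; rewrite ltnS => le_n.
  case: (posnP (depth (flip t) (flipb t B))) => [->//|].
  move=> /depth_attained[_ /flipP[C Ct ->] [tBC dBC dC]].
  have rC : (depth (flip t) (flipb t C) <= row_of C)%N.
    by apply: IH => //; rewrite dC.
  rewrite -dC; apply: (leq_ltn_trans rC); move: tBC dBC; rewrite /touch /= => tBC dBC.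
  case: (ltngtP (row_of B) (row_of C)) => // r.
  - by have := depth_lt Ct tBC r; lia.
  - by move: dBC; rewrite (ot _ _ Bt Ct tBC r) ltnn.
have [n] := ubnP (row_of B).
elim: n => // n IH in B Bt *; rewrite ltnS => le_n.
case: (posnP (row_of B)) => [->//|/(st _ Bt)[C Ct [tBC rC]]].
have rB : (row_of C <= depth (flip t) (flipb t C))%N by apply: IH => //; lia.
rewrite -rC; apply: (leq_ltn_trans rB); apply: depth_lt => //; first exact: mem.
by apply: depth_lt => //; [rewrite touchC|rewrite -rC].
Qed.

Lemma flipK t : heap t -> flip (flip t) = t.
Proof.
move=> ht; apply/fsetP => B; apply/flipP/idP.
  by case=> _ /flipP[C Ct ->] ->; rewrite flipbK.
move=> Bt; exists (flipb t B); last by rewrite flipbK.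
by apply/flipP; exists B.
Qed.

Lemma flipb_inj t : heap t -> {in t &, injective (flipb t)}.
Proof. by move=> ht B C Bt Ct e; rewrite -(flipbK ht Bt) e flipbK. Qed.

(** A block off the ground touches its support, which has larger depth and so passes above it. The
    other blocks that touch a ground block are all higher, hence of smaller depth. *)
Lemma maximal_flip t B : heap t -> B \in t ->
  maximal (flip t) (flipb t B) <-> row_of B = 0%N.
Proof.
move=> ht Bt; have [wt ot st] := ht; split.
  case=> _ mB; apply/eqP; rewrite eqn0Ngt; apply/negP => /(st _ Bt)[C Ct [tBC rC]].
  have : (depth t C <= depth t B)%N.
    by apply: (mB (flipb t C)) => //; apply/flipP; exists C.
  by rewrite leqNgt depth_lt // 1?touchC // -rC.
move=> rB; split; first by apply/flipP; exists B.
move=> _ /flipP[C Ct ->] /= tBC; case: (posnP (row_of C)) => rC.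
  by rewrite (ot _ _ Bt Ct tBC) // rB.
by apply/ltnW/depth_lt => //; rewrite rB.
Qed.

Lemma perm_imfset (T U : choiceType) (f : T -> U) (t : {fset T}) :
  {in t &, injective f} -> perm_eq [fset f x | x in t]%fset (map f t).
Proof.
move=> f_inj; apply: uniq_perm; first exact: fset_uniq.
  by rewrite map_inj_in_uniq ?fset_uniq.
by move=> x; apply/imfsetP/mapP => -[y yt ->]; exists y.
Qed.

(** Stated for any injection preserving widths, to serve both flips and translations. *)
Lemma typed_imfset m (s k : 'I_m -> nat) (f : block -> block) t :
  {in t &, injective f} -> (forall B, width_of (f B) = width_of B) ->
  typed s k [fset f B | B in t]%fset <-> typed s k t.
Proof.
move=> f_inj wf; rewrite /typed /nb_width.
have nbE i : #|` [fset C in [fset f B | B in t] | width_of C == s i]%fset| =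
    #|` [fset C in t | width_of C == s i]%fset|.
  rewrite !card_fset_filter (permP (perm_imfset f_inj)) count_map.
  by apply: eq_count => B /=; rewrite wf.
have wE : (forall C, C \in [fset f B | B in t]%fset -> exists i, width_of C = s i)
    <-> (forall B, B \in t -> exists i, width_of B = s i).
  split=> h B Bt; first by rewrite -wf; apply: h; apply/imfsetP; exists B.
  by have /imfsetP[C Ct ->] := Bt; rewrite wf; apply: h.
by split=> -[/wE h1 h2]; split=> // i; rewrite -h2 nbE.
Qed.

(** * Bottom rows as chains of blocks *)

Definition ground (t : {fset block}) : {fset block} :=
  [fset B in t | row_of B == 0%N]%fset.

Lemma groundP t B : B \in ground t <-> B \in t /\ row_of B = 0%N.
Proof. by rewrite !inE; split=> [/andP[? /eqP]|[-> /eqP]]. Qed.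

Definition covers (X : {fset block}) (c : int) : Prop :=
  exists2 B, B \in X & occupies B c.

(** Starting the bottom row at column 0 selects one representative of each translation class. *)
Definition grounded m (s k : 'I_m -> nat) (b : nat) (t : {fset block}) : Prop :=
  [/\ heap t, typed s k t, #|` ground t| = b
    & exists2 e', 0 < e' & forall c, covers (ground t) c <-> 0 <= c < e'].

Lemma chain_transfer (P Q : block -> Prop) e b e' :
  (forall B, P B -> exists C,
     [/\ Q C, left_of C = left_of B & width_of C = width_of B]) ->
  chain P e b e' -> chain Q e b e'.
Proof.
move=> PQ; elim: b e => [//|b IH] e /= [B [PB lB c]].
have [C [QC lC wC]] := PQ _ PB; exists C; rewrite lC wC; split=> //; exact: IH.
Qed.

(** Disjoint blocks tile an interval exactly when, read from left to right, they form a chain. The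
    condition on the left that every block meets the interval excludes blocks outside the chain.
    Induction on [b] removes the block that starts at [e]. *)
Lemma chain_coverP (X : {fset block}) e b e' :
  (forall B, B \in X -> (0 < width_of B)%N) ->
  (forall B C, B \in X -> C \in X -> touch B C -> B = C) ->
  (chain (fun B => B \in X) e b e' /\
   forall B, B \in X -> exists2 c, occupies B c & e <= c < e') <->
  [/\ #|` X| = b, e <= e' & forall c, covers X c <-> e <= c < e'].
Proof.
elim: b => [|b IH] in X e * => wX oX.
  split=> [[/= -> cX]|[/eqP]].
    have X0 : X = fset0.
      by case: (fset_0Vmem X) => // -[B /cX[c _]]; lia.
    rewrite X0 cardfs0; split=> // c; split; last by lia.
    by case=> B; rewrite inE.
  rewrite cardfs_eq0 => /eqP -> ee' cX; split; last by move=> B; rewrite inE.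
  case: (ltrP e e') => [lt|] /=; last by lia.
  by have [] : covers fset0 e; [apply/cX; lia|move=> B; rewrite inE].
have occ B c C : B \in X -> C \in X -> occupies B c -> occupies C c -> B = C.
  move=> BX CX hB hC; apply: oX => //; apply/share_columnP; [exact: wX|exact: wX|].
  by exists c.
have sub B : (forall C, C \in (X `\ B)%fset -> (0 < width_of C)%N) /\
  (forall C D, C \in (X `\ B)%fset -> D \in (X `\ B)%fset -> touch C D -> C = D).
  split=> [C /fsetD1P[_ /wX]//|C D /fsetD1P[_ CX] /fsetD1P[_ DX]]; exact: oX.
split.
  case=> /= -[B [BX lB ch]] mX; have [w' o'] := sub B; have wB := wX _ BX.
  have [|cX' le' cov] := (IH _ (e + (width_of B)%:Z) w' o').1.
    split.
      apply: (@chain_mono (fun C => C \in X) _ _ _ _ _ _ (lexx _)) ch => C CX lC.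
      by apply/fsetD1P; split=> //; apply/eqP => CB; move: lC; rewrite CB; lia.
    move=> C /fsetD1P[/eqP CB CX]; have [c cC ce] := mX _ CX; exists c => //.
    suff : ~~ occupies B c by move: cC ce; rewrite /occupies lB; lia.
    by apply/negP => cB; apply/CB/(occ _ c).
  split; first by rewrite (cardfsD1 B) BX cX'.
    by lia.
  move=> c; split.
    case=> C CX cC; have [e1|/eqP CB] := eqVneq C B.
      by move: cC; rewrite e1 /occupies lB; lia.
    suff : e + (width_of B)%:Z <= c < e' by lia.
    by apply/cov; exists C => //; apply/fsetD1P; split=> //; apply/eqP.
  move=> ce; case: (ltrP c (e + (width_of B)%:Z)) => h.
    by exists B => //; rewrite /occupies lB; lia.
  by have [|C /fsetD1P[_ CX] cC] := (cov c).2 _; [lia|exists C].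
case=> cX ee' cov.
have lX C : C \in X -> e <= left_of C < e'.
  move=> CX; apply/cov; exists C => //; rewrite /occupies; have := wX _ CX; lia.
have [C0 C0X] : exists C, C \in X by apply/fset0Pn; rewrite -cardfs_gt0 cX.
have [B BX oB] : covers X e by apply/cov; have := lX _ C0X; lia.
(* [B] covers [e], and no block of [X] starts before [e]. *)
have lB : left_of B = e by move: oB (lX _ BX); rewrite /occupies; lia.
have [w' o'] := sub B; have wB := wX _ BX.
have rB : e + (width_of B)%:Z <= e'.
  have : e <= e + (width_of B)%:Z - 1 < e'; last by lia.
  by apply/cov; exists B => //; rewrite /occupies lB; lia.
have [|ch' _] := (IH _ (e + (width_of B)%:Z) w' o').2.
  split=> //; first by move: cX; rewrite (cardfsD1 B) BX => -[].
  move=> c; split.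
    case=> C /fsetD1P[/eqP CB CX] cC.
    have ce : e <= c < e' by apply/cov; exists C.
    suff : ~~ occupies B c by move: ce; rewrite /occupies lB; lia.
    by apply/negP => cB; apply/CB/(occ _ c).
  move=> ce; have [|C CX cC] := (cov c).2 _; first by lia.
  exists C => //; apply/fsetD1P; split=> //; apply/eqP => CB.
  by move: cC; rewrite CB /occupies lB; lia.
split.
  exists B; split=> //; apply: chain_transfer ch' => C /fsetD1P[_ CX].
  by exists C.
move=> C CX; exists (left_of C); last exact: lX.
by rewrite /occupies; have := wX _ CX; lia.
Qed.

(** With [w = 0] the interval to be met is exactly the one spanned by the chain, and [0 < b] makes
    it nonempty. Maximal blocks of the flipped heap correspond to ground blocks, so these tile that
    interval. *)
Lemma capped_flip m (s k : 'I_m -> nat) b t : heap t -> (0 < b)%N ->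
  capped s k 0 0 b (flip t) <-> grounded s k b t.
Proof.
move=> ht b0; have [wt ot st] := ht.
have wG B : B \in ground t -> (0 < width_of B)%N by case/groundP => /wt.
have oG B C : B \in ground t -> C \in ground t -> touch B C -> B = C.
  move=> /groundP[Bt rB] /groundP[Ct rC] tBC; apply: ot => //; by rewrite rB.
have tE : typed s k (flip t) <-> typed s k t.
  by apply: typed_imfset => //; apply: flipb_inj.
have to B : B \in ground t -> maximal (flip t) (flipb t B).
  by case/groundP => Bt rB; apply/maximal_flip.
have from B : maximal (flip t) B -> exists2 C, C \in ground t & B = flipb t C.
  move=> mB; have [/flipP[C Ct eB] _] := mB; rewrite eB in mB.
  by exists C => //; apply/groundP; split=> //; apply/(maximal_flip ht Ct).
have chE e' : chain (maximal (flip t)) (0 + 0%:Z) b e' <->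
    chain (fun B => B \in ground t) 0 b e'.
  split; first by apply: chain_transfer => B /from[C Cg ->]; exists C.
  by apply: chain_transfer => B /to mB; exists (flipb t B).
have pos e' : chain (fun B => B \in ground t) 0 b e' -> 0 < e'.
  case: (b) b0 => // b' _ /= [B [/wG wB _ /chain_le]]; lia.
split.
  case=> _ /tE tt [e' /chE ch mt].
  have [|cb _ cov] := (chain_coverP 0 b e' wG oG).1.
    split=> // B Bg; have := mt _ (to _ Bg); have := pos _ ch; have := wG _ Bg.
    rewrite /meets /occupies /= => wB e'0 mB.
    (* A block that meets the interval contains its own left end in it, or else column 0. *)
    case: (lerP 0 (left_of B)) => lB; first by exists (left_of B); lia.
    by exists 0; lia.
  by split=> //; exists e' => //; apply: pos.
case=> _ tt cb [e' e'0 cov]; split; [exact: heap_flip|exact/tE|exists e'].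
  have [|ch _] := (chain_coverP 0 b e' wG oG).2; last exact/chE.
  by split=> //; apply: ltW.
move=> B /from[C Cg ->]; have wC := wG _ Cg.
have : 0 <= left_of C < e'; last by rewrite /meets /=; lia.
by apply/cov; exists C => //; rewrite /occupies; lia.
Qed.

Lemma counted_grounded m (s k : 'I_m -> nat) (n b : nat) :
  injective s -> (forall i, (0 < s i)%N) ->
  n = (\sum_i k i)%N -> (0 < b)%N ->
  counted (grounded s k b)
    (multinomial k * binomz (\sum_i s i * k i - 1) (n%:Z - b%:Z)).
Proof.
move=> s_inj s0 nk b0; rewrite -[X in binomz (X - 1)]addn0.
have cc := counted_capped 0 s_inj s0 nk (b0 : (0 < 0 + b)%N).
have flip_inj t u : capped s k 0 0 b t -> capped s k 0 0 b u ->
    flip t = flip u -> t = u.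
  by move=> [ht _ _] [hu _ _] e; rewrite -(flipK ht) e flipK.
apply: (counted_ext _ (counted_image flip_inj cc)) => t.
split=> [[u cu <-]|gt].
  by have [hu _ _] := cu; rewrite -capped_flip ?flipK //; exact: heap_flip.
have [ht _ _ _] := gt; exists (flip t); last exact: flipK.
exact/capped_flip.
Qed.

(** Double counting: [s] being injective, each block has exactly one width index. *)
Lemma card_typed m (s k : 'I_m -> nat) t : injective s -> typed s k t ->
  #|` t| = (\sum_i k i)%N.
Proof.
move=> s_inj [ws kt]; rewrite card_fset_sum1.
transitivity (\sum_(B <- t) \sum_i (width_of B == s i))%N.
  rewrite big_seq [RHS]big_seq; apply: eq_bigr => B /ws[i wB].
  rewrite (bigD1 i) //= wB eqxx big1 // => j ji.
  by rewrite (inj_eq s_inj) eq_sym (negPf ji).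
rewrite exchange_big /=; apply: eq_bigr => i _.
rewrite -kt /nb_width card_fset_filter -sum1_count [RHS]big_mkcond.
by apply: eq_bigr => B _; case: (_ == _).
Qed.

Lemma covers_ground t c : covers (ground t) c <-> bottom_columns t c.
Proof.
split=> [[B /groundP[Bt rB] cB]|[B [Bt rB cB]]]; first by exists B.
by exists B => //; apply/groundP.
Qed.

Definition normalized (t : {fset block}) : Prop :=
  exists2 e', 0 < e' & forall c, bottom_columns t c <-> 0 <= c < e'.

Lemma heap_tower m (s : 'I_m -> nat) t : (forall i, (0 < s i)%N) ->
  omino_tower s t -> heap t.
Proof.
move=> s0 [_ ws ot _ st].
have wt B : B \in t -> (0 < width_of B)%N by move=> /ws[i ->].
split=> // [B C Bt Ct tBC rBC|B Bt /(st _ Bt)[C [Ct rC sBC]]].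
  apply: contrapT => BC; apply: (ot _ _ Bt Ct BC rBC).
  by apply/share_columnP => //; apply: wt.
by exists C => //; split=> //; apply/share_columnP => //; apply: wt.
Qed.

Lemma towers_grounded m (s k : 'I_m -> nat) n b t :
  injective s -> (forall i, (0 < s i)%N) -> n = (\sum_i k i)%N ->
  ((towers s k n t /\ nb_bottom t = b) /\ normalized t) <-> grounded s k b t.
Proof.
move=> s_inj s0 nk; split.
  case=> -[[tt _ kt] bt] [e' e'0 cov]; have [_ ws _ _ _] := tt.
  split=> //; first exact: heap_tower tt.
  by exists e' => // c; rewrite covers_ground.
case=> [ht tt bt [e' e'0 cov]]; have [wt ot st] := ht.
have cov' c : bottom_columns t c <-> 0 <= c < e' by rewrite -covers_ground.
split; last by exists e'.
split=> //; split; [|by rewrite nk; apply: card_typed tt|exact: tt.2].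
split.
- have [B [Bt _ _]] : bottom_columns t 0 by apply/cov'; lia.
  by apply/fset0Pn; exists B.
- exact: tt.1.
- move=> B C Bt Ct BC rBC /share_columnP tBC.
  by apply/BC/ot => //; apply: tBC; apply: wt.
- by move=> c1 c c2 h1 h2 /cov' c1' /cov' c2'; apply/cov'; lia.
- move=> B Bt /(st _ Bt)[C Ct [tBC rC]]; exists C; split=> //.
  by apply/share_columnP => //; apply: wt.
Qed.

(** * Translations *)

Definition shift (j : int) (B : block) : block :=
  Block (row_of B) (left_of B + j) (width_of B).

Lemma shift_inj j : injective (shift j).
Proof. by move=> [r l w] [r' l' w'] [-> /addIr -> ->]. Qed.

Lemma translateP j t B :
  reflect (exists2 C, C \in t & B = shift j C) (B \in translate j t).
Proof. exact: imfsetP. Qed.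

Lemma translate0 t : translate 0 t = t.
Proof.
apply/fsetP => B; apply/translateP/idP => [[[r l w] Bt ->]|Bt].
  by rewrite /shift /= addr0.
by exists B => //; rewrite /shift addr0; case: B Bt.
Qed.

Lemma translateD i j t : translate i (translate j t) = translate (j + i) t.
Proof.
apply/fsetP => B; apply/translateP/translateP.
  by case=> _ /translateP[C Ct ->] ->; exists C; rewrite // /shift /= addrA.
case=> C Ct ->; exists (shift j C); last by rewrite /shift /= addrA.
by apply/translateP; exists C.
Qed.

Lemma occupies_shift j B c : occupies (shift j B) c = occupies B (c - j).
Proof. by rewrite /occupies /=; lia. Qed.

Lemma bottom_translate j t c :
  bottom_columns (translate j t) c <-> bottom_columns t (c - j).
Proof.
split=> [[_ [/translateP[B Bt ->] rB cB]]|[B [Bt rB cB]]].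
  by exists B; rewrite -occupies_shift.
exists (shift j B); rewrite occupies_shift; split=> //.
by apply/translateP; exists B.
Qed.

Lemma share_column_shift j B C :
  share_column (shift j B) (shift j C) <-> share_column B C.
Proof.
rewrite /share_column; split=> -[c [cB cC]].
  by exists (c - j); rewrite -!occupies_shift.
by exists (c + j); rewrite !occupies_shift addrK.
Qed.

Lemma omino_tower_translate m (s : 'I_m -> nat) j t :
  omino_tower s t -> omino_tower s (translate j t).
Proof.
case=> t0 ws ot ct st; split.
- have /fset0Pn[B Bt] := t0; apply/fset0Pn; exists (shift j B).
  by apply/translateP; exists B.
- by move=> _ /translateP[B Bt ->]; exact: (ws B).
- move=> _ _ /translateP[B Bt ->] /translateP[C Ct ->] BC rBC.
  rewrite share_column_shift; apply: ot => // eBC; apply: BC; by rewrite eBC.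
- move=> c1 c c2 h1 h2 /bottom_translate b1 /bottom_translate b2.
  by apply/bottom_translate; apply: ct b1 b2; lia.
- move=> _ /translateP[B Bt ->] /(st _ Bt)[C [Ct rC sBC]].
  exists (shift j C); split=> //; last exact/share_column_shift.
  by apply/translateP; exists C.
Qed.

Lemma towers_translate m (s k : 'I_m -> nat) n j t :
  towers s k n t -> towers s k n (translate j t).
Proof.
case=> ot ct kt; split; first exact: omino_tower_translate.
- by rewrite -ct; apply: card_imfset; exact: shift_inj.
- have [_ ws _ _ _] := ot.
  have /(typed_imfset s k) h : {in t &, injective (shift j)}.
    by move=> B C _ _; apply: shift_inj.
  by have [] := (h (fun=> erefl)).2 (conj ws kt).
Qed.

Lemma nb_bottom_translate j t : nb_bottom (translate j t) = nb_bottom t.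
Proof.
rewrite /nb_bottom !card_fset_filter.
rewrite (permP (perm_imfset (in2W (@shift_inj j)))) count_map.
exact: eq_count.
Qed.

Lemma seq_argmin (T : eqType) (f : T -> int) (r : seq T) x : x \in r ->
  exists2 y, y \in r & forall z, z \in r -> f y <= f z.
Proof.
elim: r x => [//|a r IH] x _; case: r IH => [|b r] IH.
  by exists a; rewrite ?inE // => z; rewrite inE => /eqP ->.
have [y yr my] := IH b (mem_head _ _).
case: (lerP (f a) (f y)) => h.
  exists a; first exact: mem_head.
  move=> z; rewrite inE => /orP[/eqP ->//|/my]; exact: le_trans.
exists y; first by rewrite inE yr orbT.
by move=> z; rewrite inE => /orP[/eqP ->|/my//]; apply: ltW.
Qed.

(** Descending along supports reaches row 0. The bottom row then runs from its least left end to its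
    greatest right end, and convexity fills the columns between. *)
Lemma tower_bottom m (s : 'I_m -> nat) t : (forall i, (0 < s i)%N) ->
  omino_tower s t ->
  exists a e : int, a < e /\ forall c, bottom_columns t c <-> a <= c < e.
Proof.
move=> s0 [t0 ws _ ct st].
have wt B : B \in t -> (0 < width_of B)%N by move=> /ws[i ->].
have [B0 [B0t rB0]] : exists B, B \in t /\ row_of B = 0%N.
  have /fset0Pn[B Bt] := t0; have [n] := ubnP (row_of B).
  elim: n => // n IH in B Bt *; rewrite ltnS => le_n.
  case: (posnP (row_of B)) => [r0|/(st _ Bt)[C [Ct rC _]]]; first by exists B.
  by apply: (IH C) => //; lia.
have B0g : B0 \in ground t by apply/groundP.
have [L /groundP[Lt rL] mL] := seq_argmin left_of B0g.
(* Minimizing the opposite of the right end finds the rightmost block. *)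
have [H /groundP[Ht rH] mH] :=
  seq_argmin (fun B => - (left_of B + (width_of B)%:Z)) B0g.
exists (left_of L), (left_of H + (width_of H)%:Z).
have bL : bottom_columns t (left_of L).
  by exists L; split=> //; rewrite /occupies; have := wt _ Lt; lia.
have bH : bottom_columns t (left_of H + (width_of H)%:Z - 1).
  by exists H; split=> //; rewrite /occupies; have := wt _ Ht; lia.
have cols c : bottom_columns t c ->
    left_of L <= c < left_of H + (width_of H)%:Z.
  move=> [B [Bt rB cB]]; have Bg : B \in ground t by apply/groundP.
  by have := mL _ Bg; have := mH _ Bg; move: cB; rewrite /occupies /=; lia.
split; first by have := cols _ bL; lia.
by move=> c; split=> [/cols//|hc]; apply: ct bL bH; lia.
Qed.

(** Column 0 is occupied in both sets; comparing it with the other interval gives [0 <= j] and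
    [0 <= - j]. *)
Lemma normalized_translate j t : normalized t -> normalized (translate j t) ->
  j = 0.
Proof.
move=> [e e0 he] [e' e'0 he'].
have h1 : 0 <= j < e'.
  by apply/he'/bottom_translate; rewrite subrr; apply/he; lia.
have : 0 <= 0 - j < e by apply/he/bottom_translate/he'; lia.
lia.
Qed.

(** Every class has exactly one normalized member, obtained by moving the start [a] of the bottom
    row to column 0, so positions in the list [l] index the classes. *)
Lemma count_normalized (P : set {fset block}) N :
  (forall j t, P t -> P (translate j t)) ->
  (forall t, P t ->
     exists a e : int, a < e /\ forall c, bottom_columns t c <-> a <= c < e) ->
  counted (fun t => P t /\ normalized t) N -> count_up_to_translation P N.
Proof.
move=> Ptr Pbot [l [ul lP <-]]; rewrite /count_up_to_translation.
have class_self t : translation_class t t.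
  by exists 0 => //; exact: translate0.
have -> : [set translation_class t | t in P] =
    [set translation_class (nth fset0 l i) | i in `I_(size l)].
  apply/seteqP; split=> [_ [t Pt <-]|_ [i /= il <-]]; last first.
    by exists (nth fset0 l i) => //; have [] := (lP _).1 (mem_nth fset0 il).
  have [a [e [ae he]]] := Pbot _ Pt.
  have tl : translate (- a) t \in l.
    apply/lP; split; first exact: Ptr.
    exists (e - a); first by lia.
    by move=> c; rewrite bottom_translate he; lia.
  exists (index (translate (- a) t) l); first by rewrite /= index_mem.
  rewrite nth_index //; apply/seteqP; split=> [_ [j _ <-]|_ [j _ <-]].
    by exists (- a + j) => //; rewrite translateD.
  by exists (a + j) => //; rewrite translateD addrA addNr add0r.
apply: inj_card_eq => i j; rewrite !inE /= => il jl e.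
apply/eqP; rewrite -(nth_uniq fset0 _ _ ul) //; apply/eqP.
have [_ ni] := (lP _).1 (mem_nth fset0 il).
have [_ nj] := (lP _).1 (mem_nth fset0 jl).
have := class_self (nth fset0 l j); rewrite -e => -[d _ ed].
rewrite -ed in nj; rewrite -ed.
by rewrite (normalized_translate ni nj) translate0.
Qed.

(** * The hypergeometric value *)

Lemma limn_series_finite (R : realType) (u : nat -> R) n :
  (forall j, (n <= j)%N -> u j = 0) -> limn (series u) = \sum_(0 <= j < n) u j.
Proof.
move=> u0; apply: lim_near_cst => //; near=> p.
have np : (n <= p)%N by near: p; exact: nbhs_infty_ge.
rewrite seriesEnat /= (big_cat_nat _ np) //= [X in _ + X]big_nat [X in _ + X]big1 ?addr0 //.
by move=> j /andP[/u0].
Unshelve. all: by end_near.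
Qed.

(** The ratio of consecutive terms is [(p - j) / (V - p + 1 + j)], the same as that of
    ['C(V, p - j.+1)] to ['C(V, p - j)]. It is zero at [j = p], so the series stops there. *)
Lemma hyp2F1_binomial (R : realType) (V p : nat) : (p <= V)%N ->
  'C(V, p)%:R * hyp2F1 1 (1 - p.+1%:R) (1 + (V - p)%:R) (-1) =
  \sum_(0 <= j < p.+1) ('C(V, p - j))%:R :> R.
Proof.
move=> pV; set u := fun j : nat => rising (1 : R) j *
  rising (1 - p.+1%:R) j / rising (1 + (V - p)%:R) j * ((-1) ^+ j / j`!%:R).
have risingS (x : R) j : rising x j.+1 = rising x j * (x + j%:R).
  by rewrite /rising big_nat_recr.
have uS j : u j.+1 = u j * ((p%:R - j%:R) / (1 + (V - p)%:R + j%:R)).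
  have c0 : (1 + (V - p)%:R + j%:R : R) != 0.
    by rewrite nat1r -natrD pnatr_eq0.
  have j0 : (1 + j%:R : R) != 0 by rewrite nat1r pnatr_eq0.
  have r0 : rising (1 + (V - p)%:R : R) j != 0.
    by apply/lt0r_neq0/prodr_gt0 => i _; rewrite nat1r -natrD ltr0n.
  have f0 : (j`!%:R : R) != 0 by rewrite pnatr_eq0 -lt0n fact_gt0.
  rewrite /u !risingS factS natrM exprS -[j.+1]add1n -[p.+1]add1n !natrD.
  by field; rewrite c0 j0 r0 f0.
have uE j : (j <= p)%N -> 'C(V, p)%:R * u j = 'C(V, p - j)%:R.
  elim: j => [_|j IH jp].
    by rewrite /u /rising !big_geq // subn0 expr0 fact0 !mul1r !invr1 !mulr1.
  rewrite uS mulrA IH 1?ltnW //.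
  have c0 : (1 + (V - p)%:R + j%:R : R) != 0.
    by rewrite nat1r -natrD pnatr_eq0.
  apply: (mulIf c0); rewrite mulrA divfK // -natrB 1?ltnW // nat1r -natrD -!natrM.
  have := mul_bin_left V (p - j.+1); rewrite subnSK // => e.
  by congr _%:R; rewrite [LHS]mulnC e mulnC; congr muln; lia.
have u0 j : (p.+1 <= j)%N -> u j = 0.
  elim: j => [//|j IH]; rewrite ltnS leq_eqVlt => /orP[/eqP <-|/IH u0].
    by rewrite uS subrr mul0r mulr0.
  by rewrite uS u0 mul0r.
rewrite /hyp2F1 (limn_series_finite u0) big_distrr /=.
by apply: eq_big_nat => j /andP[_]; rewrite ltnS => /uE.
Qed.

(** * From grounded heaps to the two counts of towers *)

Theorem theorem1 (R : realType) (m : nat) (s : 'I_m -> nat)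
    (s_inj : injective s) (s_gt0 : forall i, (0 < s i)%N)
    (k : 'I_m -> nat) (n : nat) (n_def : n = (\sum_(i < m) k i)%N)
    (n_ge1 : (1 <= n)%N) :
  (forall b : nat, (1 <= b)%N ->
     count_up_to_translation
       [set t | towers s k n t /\ nb_bottom t = b]
       (multinomial k *
        binomz (\sum_(i < m) s i * k i - 1) (n%:Z - b%:Z)%R)%N)
  /\
  (exists N : nat,
     count_up_to_translation (towers s k n) N /\
     N%:R = (multinomial k)%:R * ('C(\sum_(i < m) s i * k i - 1, n - 1))%:R *
            hyp2F1 1 (1 - n%:R)
              (1 + \sum_(i < m) ((s i)%:R - 1) * (k i)%:R) (-1) :> R).
Proof.
have le_W : (n <= \sum_(i < m) s i * k i)%N.
  by rewrite n_def; apply: leq_sum => i _; rewrite leq_pmull.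
have gc b : (1 <= b)%N -> counted (grounded s k b)
    (multinomial k * binomz (\sum_(i < m) s i * k i - 1) (n%:Z - b%:Z)).
  exact: counted_grounded.
have bot t : towers s k n t ->
    exists a e : int, a < e /\ forall c, bottom_columns t c <-> a <= c < e.
  by case=> /(tower_bottom s_gt0).
split.
  move=> b b1; apply: count_normalized.
  - move=> j t [tt tb]; split; first exact: towers_translate.
    by rewrite nb_bottom_translate.
  - by move=> t [/bot].
  - apply: counted_ext (gc _ b1) => t.
    exact: iff_sym (towers_grounded b t s_inj s_gt0 n_def).
(* The counts of the first part are added; different [b] give disjoint families since [b] is the
   size of the ground row. *)
exists (\sum_(b <- iota 1 n) multinomial k *
  binomz (\sum_(i < m) s i * k i - 1) (n%:Z - b%:Z))%N; split.
  apply: count_normalized => //; first exact: towers_translate.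
  apply: (counted_ext (P := fun t => exists2 b, b \in iota 1 n & grounded s k b t)).
    move=> t; split=> [[b _ /(towers_grounded _ _ s_inj s_gt0 n_def)[[tt _] nt]]|].
      by split.
    move=> [tt nt]; exists (nb_bottom t); last first.
      exact/(towers_grounded _ _ s_inj s_gt0 n_def).
    have [_ <- _] := tt; have [e e0 cov] := nt; rewrite mem_iota add1n ltnS.
    apply/andP; split.
      have [|B [Bt rB _]] := (cov 0).2; first by lia.
      by rewrite cardfs_gt0; apply/fset0Pn; exists B; apply/groundP.
    by apply/fsubset_leq_card/fsubsetP => B /groundP[].
  apply: counted_bigU; first exact: iota_uniq.
    by move=> b; rewrite mem_iota => /andP[b1 _]; apply: gc.
  by move=> b b' t _ _ [_ _ <- _] [_ _ <- _].
set W := (\sum_(i < m) s i * k i)%N in le_W *.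
(* The third parameter is [1 + (W - n)], put in the form of [hyp2F1_binomial] for [V = W - 1] and
   [p = n - 1]. *)
have -> : (1 + \sum_(i < m) ((s i)%:R - 1) * (k i)%:R : R) =
    1 + (W - 1 - (n - 1))%:R.
  have -> : (W - 1 - (n - 1) = W - n)%N by lia.
  rewrite natrB // /W n_def !natr_sum -sumrB; congr (_ + _).
  by apply: eq_bigr => i _; rewrite mulrBl mul1r natrM.
have n1 : (n - 1).+1 = n by lia.
rewrite -mulrA -{4}n1 hyp2F1_binomial; last by lia.
rewrite -big_distrr natrM; congr (_ * _).
rewrite n1 natr_sum.
(* Setting [b = j.+1] turns the lower index [n - b] into [p - j]. *)
have -> : iota 1 n = index_iota 1 n.+1 by rewrite /index_iota subn1.
rewrite big_add1 /=; apply: eq_big_nat => j /andP[_ jn].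
have -> : n%:Z - j.+1%:Z = (n - 1 - j)%N by lia.
by [].
Qed.
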